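(* Let $\mathcal H$ be a real or complex Hilbert space, let $\mathcal D\subseteq\mathcal H$ be a linear subspace and let $T:\mathcal D\to\mathcal H$ be a linear operator possessing a bounded positive extension to $\mathcal H$. For every bounded positive extension $S$ of $T$ (to $\mathcal H$) we have $$\operatorname{ran}(S-T_N)^{1/2}=\operatorname{ran}S^{1/2}\cap\mathcal D^\perp.$$
   Context: A bounded positive operator on $\mathcal H$ is an everywhere defined bounded self-adjoint operator with nonnegative quadratic form; $A^{1/2}$ denotes its positive square root. $T_N$ denotes the Krein-von Neumann extension of $T$: the smallest positive self-adjoint extension of $T$, which under the stated hypothesis is a bounded positive operator on $\mathcal H$ with $T_N\le S$ for every bounded positive extension $S$ of $T$. Concretely $T_N=J_T^{**}J_T^*$, where $\mathcal E_T$ is the completion of $\operatorname{ran}T$ under the (well-defined) inner product $\langle Tf,Th\rangle_{\mathcal E}:=\langle Tf,h\rangle$ ($f,h\in\mathcal D$), and $J_T:\mathcal E_T\to\mathcal H$ is the densely defined closable operator with $\operatorname{dom}J_T=\operatorname{ran}T$ and $J_T(Th):=Th$. *)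

(* Defs.v *)
From HB Require Import structures.
From mathcomp Require Import all_boot all_order all_algebra.
From mathcomp Require Import sesquilinear complex.
From mathcomp Require Import all_classical all_reals all_analysis.

Set Implicit Arguments.
Unset Strict Implicit.
Unset Printing Implicit Defensive.

Import Order.TTheory GRing.Theory Num.Theory.
Import numFieldNormedType.Exports.

Local Open Scope classical_set_scope.
Local Open Scope ring_scope.

Variant scalar_kind := RealScalars | ComplexScalars.

Definition scalars (R : realType) (k : scalar_kind) : numFieldType :=
  match k with
  | RealScalars => R : numFieldType
  | ComplexScalars => R[i] : numFieldType
  end.

Definition scalar_conj (R : realType) (k : scalar_kind) :
    scalars R k -> scalars R k :=
  match k with
  | RealScalars => fun x : R => x
  | ComplexScalars => fun z : R[i] => conjc z
  end.
Arguments scalar_conj {R k} _.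

Section Operators.
Context {K : numFieldType} {theta : K -> K} {H : completeNormedModType K}.
Variable ip : {dot H for theta}.
Implicit Types (A B S T : H -> H) (D : set H).

(* A Hilbert space is a Banach space whose norm is induced by an inner
   product, taken to be linear in its first argument. *)
Definition induces_norm := forall x : H, ip x x = `|x| ^+ 2.

Definition linear_subspace D :=
  D 0 /\ forall (a : K) (x y : H), D x -> D y -> D (a *: x + y).

(* An operator with domain D is represented by a function on H whose values
   outside D are never used. *)
Definition linear_on D T :=
  forall (a : K) (x y : H), D x -> D y -> T (a *: x + y) = a *: T x + T y.

Definition bounded_operator A :=
  linear A /\ exists M : K, forall x : H, `|A x| <= M * `|x|.

Definition self_adjoint A := forall x y : H, ip (A x) y = ip x (A y).

(* Over R[i], 0 <= z says that z is real and nonnegative. *)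
Definition bounded_positive A :=
  [/\ bounded_operator A, self_adjoint A & forall x : H, 0 <= ip (A x) x].

Definition operator_le A B := forall x : H, ip (A x) x <= ip (B x) x.

Definition positive_extension D T S :=
  bounded_positive S /\ forall x : H, D x -> S x = T x.

Definition smallest_positive_extension D T A :=
  positive_extension D T A /\
  forall S, positive_extension D T S -> operator_le A S.

(* The smallest extension is unique, since operator_le is antisymmetric on
   bounded positive operators. It exists as soon as T has a bounded positive
   extension; the default value 0 is used only when there is none. *)
Definition krein_von_neumann D T : H -> H :=
  xget (fun=> 0) (smallest_positive_extension D T).

(* A bounded positive operator has exactly one positive square root; the
   default value 0 is used only when A is not positive. *)
Definition sqrt_operator A : H -> H :=
  xget (fun=> 0) [set B | bounded_positive B /\ B \o B = A].

Definition orthogonal_complement D : set H :=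
  [set y | forall x, D x -> ip y x = 0].

End Operators.

(* Main.v *)
Require Import Defs.
From mathcomp Require Import all_boot all_order all_algebra.
From mathcomp Require Import sesquilinear complex ring.
From mathcomp Require Import all_classical all_reals all_analysis.

Set Implicit Arguments.
Unset Strict Implicit.
Unset Printing Implicit Defensive.

Import Order.TTheory GRing.Theory Num.Theory.
Import numFieldNormedType.Exports.

Local Open Scope classical_set_scope.
Local Open Scope ring_scope.

(* Let Q be the square root of S and P the orthogonal projection onto the
   closure of Q D. Then T_N = Q P Q: it extends T because P fixes Q D, and it
   is smallest because |P Q x|^2 is the supremum over d in D of
   <x, T d> + <T d, x> - <T d, d>, which any positive extension dominates.
   Hence S - T_N = (Q E) (E Q) with E = 1 - P. Since A A* = B B* forces
   ran A = ran B, the range of the root of S - T_N is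
   Q (ran E) = {Q y : y orthogonal to Q D} = ran Q /\ D^perp. *)

Section Hilbert.
Context {K : numFieldType} {theta : K -> K} {H : completeNormedModType K}.
Variable ip : {dot H for theta}.
Hypothesis theta_norm : forall z, z * theta z = `|z| ^+ 2.
Hypothesis archimedean : forall e : K, 0 < e -> exists n, n.+1%:R^-1 < e.
Hypothesis ip_norm : induces_norm ip.

Implicit Types (x y z : H) (L : set H) (A B : H -> H).

Local Notation rate n := (n.+1%:R^-1 : K).

(** * Estimates with error [c / (n + 1)], and completeness in that form *)

Lemma rate_gt0 n : 0 < rate n.
Proof. by rewrite invr_gt0 ltr0n. Qed.

Lemma rate_ge0 n : 0 <= rate n.
Proof. exact: ltW (rate_gt0 n). Qed.

Lemma rate_le n m : (n <= m)%N -> rate m <= rate n.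
Proof. by move=> nm; rewrite lef_pV2 ?posrE ?ltr0n// ler_nat. Qed.

(** The order on [K] is partial, so nonnegativity serves to make [a] and [b] comparable. If [b < a],
    then [c > 0] and some [rate n] falls below [(a - b) / c]. *)
Lemma le_rate (a b c : K) :
  0 <= a -> 0 <= b -> (forall n, a <= b + c * rate n) -> a <= b.
Proof.
move=> a0 b0 abc.
have [//|ba] := real_leP (ger0_real a0) (ger0_real b0).
have dab : 0 < a - b by rewrite subr_gt0.
have c0 : 0 < c.
  by have := abc 0%N; rewrite invr1 mulr1 -lerBlDl => /(lt_le_trans dab).
have [n] := archimedean (divr_gt0 dab c0).
rewrite ltr_pdivlMr// mulrC ltrBrDl.
by move=> /(le_lt_trans (abc n)); rewrite ltxx.
Qed.

Lemma rate_eq0 x c : (forall n, `|x| <= c * rate n) -> x = 0.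
Proof.
move=> xc; apply/normr0_eq0/eqP; rewrite eq_le normr_ge0 andbT.
by apply: (@le_rate _ _ c) => // n; rewrite add0r.
Qed.

Lemma scalar_rate_eq0 (a c : K) : (forall n, `|a| <= c * rate n) -> a = 0.
Proof.
move=> ac; apply/normr0_eq0/eqP; rewrite eq_le normr_ge0 andbT.
by apply: (@le_rate _ _ c) => // n; rewrite add0r.
Qed.

Lemma complete_rate (u : nat -> H) (c : K) :
  (forall n m, (n <= m)%N -> `|u n - u m| <= c * rate n) ->
  exists l, forall n, `|u n - l| <= c * rate n.
Proof.
move=> uc.
have c0 : 0 <= c.
  by have := uc 0%N 0%N (leqnn _); rewrite subrr normr0 invr1 mulr1.
(* [c] may be 0, so the division is by [c + 1]. *)
have c1 : 0 < c + 1 by rewrite ltr_wpDl.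
have : cvg (u @ \oo).
  apply: cauchy_cvg; apply: cauchy_exP => e e0.
  have [n ne] := archimedean (divr_gt0 e0 c1).
  exists (u n); exists n => // m /= nm; rewrite -ball_normE /=.
  apply: le_lt_trans (uc _ _ nm) _.
  rewrite ltr_pdivlMr // mulrC in ne; apply: le_lt_trans ne.
  by rewrite ler_wpM2r ?rate_ge0// lerDl.
case/cvg_ex => l ul; exists l => n.
apply: (@le_rate _ _ 1) => //; first exact: mulr_ge0 c0 (ltW (rate_gt0 n)).
move=> k.
have /cvgrPdist_le /(_ (rate k) (rate_gt0 _)) [N _ lN] := ul.
have -> : u n - l = (u n - u (maxn n N)) + (u (maxn n N) - l).
  by rewrite addrA subrK.
apply: le_trans (ler_normD _ _) _; rewrite mul1r lerD//.
  by apply: uc; rewrite leq_maxl.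
by rewrite distrC; apply: lN; rewrite /= leq_maxr.
Qed.

(** * Inner product identities and Cauchy-Schwarz *)

Lemma ipC x y : ip x y = theta (ip y x).
Proof. by have := hermitian_subproof (s := ip) x y; rewrite expr0 mul1r. Qed.

Lemma ipZr (a : K) x y : ip x (a *: y) = theta a * ip x y.
Proof. exact: linearZr_LR. Qed.

Lemma ipZl (a : K) x y : ip (a *: x) y = a * ip x y.
Proof. exact: linearZl_LR. Qed.

Lemma ipDl x y z : ip (x + y) z = ip x z + ip y z.
Proof. exact: linearDl. Qed.

Lemma ipDr x y z : ip x (y + z) = ip x y + ip x z.
Proof. exact: linearDr. Qed.

Lemma ipBl x y z : ip (x - y) z = ip x z - ip y z.
Proof. exact: linearBl. Qed.

Lemma ipBr x y z : ip x (y - z) = ip x y - ip x z.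
Proof. exact: linearBr. Qed.

Lemma ip_eq0C x y : (ip x y = 0) <-> (ip y x = 0).
Proof.
suff h u v : ip u v = 0 -> ip v u = 0 by split; apply: h.
move=> uv; have := theta_norm (ip v u); rewrite -ipC uv mulr0 => /esym/eqP.
by rewrite sqrf_eq0 normr_eq0 => /eqP.
Qed.

Lemma norm_ipC x y : ip x y * ip y x = `|ip x y| ^+ 2.
Proof. by rewrite [ip y x]ipC theta_norm. Qed.

(* At 0 this can fail: theta is not assumed additive, and theta_norm says
   nothing about theta 0. *)
Lemma theta_gt0 (a : K) : 0 < a -> theta a = a.
Proof.
move=> a0; apply: (mulfI (lt0r_neq0 a0)).
by rewrite theta_norm gtr0_norm // expr2.
Qed.

Lemma ip_eq0 x : ip x x = 0 -> x = 0.
Proof. by rewrite ip_norm => /eqP; rewrite sqrf_eq0 normr_eq0 => /eqP. Qed.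

Lemma norm_sub x y : `|x - y| ^+ 2 = `|x| ^+ 2 - ip x y - ip y x + `|y| ^+ 2.
Proof. by rewrite -!ip_norm ipBl !ipBr /=; ring. Qed.

Lemma norm_add x y : `|x + y| ^+ 2 = `|x| ^+ 2 + ip x y + ip y x + `|y| ^+ 2.
Proof. by rewrite -!ip_norm ipDl !ipDr /=; ring. Qed.

(* Take for t the coefficient of the orthogonal projection of x on y. With
   e = `|x| ^+ 2 the hypothesis holds trivially and this is Cauchy-Schwarz. *)
Lemma near_minimal_ip x y (e : K) :
  (forall t : K, `|x| ^+ 2 <= `|x - t *: y| ^+ 2 + e) ->
  `|ip x y| ^+ 2 <= e * `|y| ^+ 2.
Proof.
have [-> _|y0] := eqVneq y 0.
  by rewrite linear0r !normr0 expr0n mulr0.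
have ny : 0 < `|y| ^+ 2 by rewrite exprn_gt0 // normr_gt0.
move=> /(_ (ip x y / `|y| ^+ 2)); set t := _ / _.
have ty : t * `|y| ^+ 2 = ip x y by rewrite /t divfK ?lt0r_neq0.
rewrite norm_sub ipZl ipZr normrZ exprMn -theta_norm.
have -> : t * theta t * `|y| ^+ 2 = theta t * ip x y by rewrite -ty; ring.
have -> : `|ip x y| ^+ 2 = t * ip y x * `|y| ^+ 2.
  by rewrite -norm_ipC -{1}ty; ring.
rewrite ler_pM2r //.
move=> h; rewrite -subr_ge0 in h; rewrite -subr_ge0.
by congr (is_true (_ <= _)): h; ring.
Qed.

Lemma cauchy_schwarz x y : `|ip x y| <= `|x| * `|y|.
Proof.
rewrite -ler_sqr ?nnegrE ?mulr_ge0 // exprMn.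
by apply: near_minimal_ip => t; rewrite lerDr exprn_ge0.
Qed.

(** * Algebra of linear operators *)

Lemma linear_op0 A : linear A -> A 0 = 0.
Proof. by move=> lA; have := lA (-1) 0 0; rewrite !scaleN1r !addNr. Qed.

Lemma linear_opD A : linear A -> {morph A : x y / x + y}.
Proof. by move=> lA x y; have := lA 1 x y; rewrite !scale1r. Qed.

Lemma linear_opZ A : linear A -> forall (a : K) x, A (a *: x) = a *: A x.
Proof.
by move=> lA a x; have := lA a x 0; rewrite (linear_op0 lA) !addr0.
Qed.

Lemma linear_opB A : linear A -> {morph A : x y / x - y}.
Proof.
by move=> lA x y; rewrite addrC -scaleN1r lA scaleN1r addrC.
Qed.

(** * Near minimizers and orthogonal projection *)

(* Otherwise f could be decreased by e indefinitely, so archimedeanity alone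
   suffices and no infimum is needed. *)
Lemma near_minimizer L (f : H -> K) (e : K) :
  L 0 -> (forall x, L x -> 0 <= f x) -> 0 < e ->
  exists2 x, L x & forall y, L y -> f x <= f y + e.
Proof.
move=> L0 f0 e0; apply: contrapT => nomin.
have step x : L x -> exists2 y, L y & f y + e < f x.
  move=> Lx; apply: contrapT => nstep; apply: nomin; exists x => // y Ly.
  have fye : 0 <= f y + e by rewrite addr_ge0 ?f0 // ltW.
  have [//|lt] := real_leP (ger0_real (f0 _ Lx)) (ger0_real fye).
  by exfalso; apply: nstep; exists y.
have descent n : exists2 x, L x & f x + n%:R * e <= f 0.
  elim: n => [|n [x Lx le]]; first by exists 0 => //; rewrite mul0r addr0.
  have [y Ly lt] := step _ Lx; exists y => //.
  apply: le_trans le; rewrite -[n.+1]add1n natrD mulrDl mul1r addrA lerD2r.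
  exact: ltW.
have f00 : 0 < f 0.
  have [x Lx] := step _ L0; apply: le_lt_trans.
  by rewrite addr_ge0 ?f0 // ltW.
have [n ne] := archimedean (divr_gt0 e0 f00).
have [x Lx le] := descent n.+1.
suff : f 0 < f x + n.+1%:R * e by move=> /(le_lt_trans le); rewrite ltxx.
apply: ltr_wpDl; first exact: f0.
by rewrite ltr_pdivlMr // mulrC ltr_pdivrMr ?ltr0n // mulrC in ne.
Qed.

(** Near minimizers of the distance from [x] to [L] form a Cauchy sequence by the parallelogram
    identity, and [p] is their limit. As [L] need not be closed, [p] is only approximated by points
    of [L]. *)
Lemma orthogonal_projection L x : linear_subspace L ->
  exists p, (forall n, exists2 y, L y & `|y - p| <= 2 * rate n) /\
    orthogonal_complement ip L (x - p).
Proof.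
move=> [L0 Llin].
have LZ (a : K) y : L y -> L (a *: y).
  by move=> Ly; rewrite -[a *: y]addr0; apply: Llin.
have LD y z : L y -> L z -> L (y + z).
  by move=> Ly Lz; rewrite -[y]scale1r; apply: Llin.
have min n : exists y, L y /\ forall z, L z ->
    `|x - y| ^+ 2 <= `|x - z| ^+ 2 + rate n ^+ 2.
  have [||y Ly miny] :=
    @near_minimizer L (fun y => `|x - y| ^+ 2) (rate n ^+ 2) L0.
  - by move=> ? _; rewrite exprn_ge0.
  - by rewrite exprn_gt0 // rate_gt0.
  - by exists y.
have [u uP] := choice min.
have Lu n : L (u n) by have [] := uP n.
have min_u n z : L z -> `|x - u n| ^+ 2 <= `|x - z| ^+ 2 + rate n ^+ 2.
  by have [_] := uP n; apply.
have [n m nm|p up] := @complete_rate u 2.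
  rewrite -ler_sqr ?nnegrE ?mulr_ge0 ?rate_ge0 //.
  set a := x - u n; set b := x - u m.
  (* The midpoint lies in [L], so both near-minimality bounds can be tested against it. *)
  pose w := 2^-1 *: (u n + u m).
  have Lw : L w by apply: LZ; apply: LD.
  have -> : u n - u m = b - a by rewrite /a /b opprB [RHS]addrC addrA subrK.
  have parallelogram : `|b - a| ^+ 2 =
      2 * `|a| ^+ 2 + 2 * `|b| ^+ 2 - `|b + a| ^+ 2.
    by rewrite norm_sub norm_add; ring.
  have ab : b + a = 2 *: (x - w).
    rewrite /w scalerBr scalerA divff ?pnatr_eq0 // scale1r scaler_nat mulr2n.
    by rewrite /a /b opprD addrACA [- u m - _]addrC.
  rewrite parallelogram ab normrZ exprMn normr_nat.
  have ha := min_u n _ Lw; have hb := min_u m _ Lw.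
  rewrite -subr_ge0 in ha; rewrite -subr_ge0 in hb.
  have hr : 0 <= rate n ^+ 2 - rate m ^+ 2.
    by rewrite subr_ge0 ler_sqr ?nnegrE ?rate_ge0 // rate_le.
  rewrite -subr_ge0.
  have -> : (2 * rate n) ^+ 2 - (2 * `|a| ^+ 2 + 2 * `|b| ^+ 2 -
      2 ^+ 2 * `|x - w| ^+ 2) =
      2 * (`|x - w| ^+ 2 + rate n ^+ 2 - `|a| ^+ 2) +
      2 * (`|x - w| ^+ 2 + rate m ^+ 2 - `|b| ^+ 2) +
      2 * (rate n ^+ 2 - rate m ^+ 2) by ring.
  by rewrite !addr_ge0 // mulr_ge0.
exists p; split=> [n|y Ly]; first by exists (u n).
(* In the constant 3, near-minimality of [u n] accounts for 1 and the distance from [u n] to [p] for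
   2. *)
apply: (@scalar_rate_eq0 _ (3 * `|y|)) => n.
have -> : x - p = (x - u n) + (u n - p) by rewrite addrA subrK.
rewrite ipDl; apply: le_trans (ler_normD _ _) _.
have -> : 3 * `|y| * rate n = rate n * `|y| + 2 * rate n * `|y| by ring.
apply: lerD; last first.
  by apply: le_trans (cauchy_schwarz _ _) _; rewrite ler_wpM2r.
rewrite -ler_sqr ?nnegrE ?mulr_ge0 ?rate_ge0 // exprMn.
apply: near_minimal_ip => t.
have -> : x - u n - t *: y = x - (t *: y + u n) by rewrite opprD addrA addrAC.
by apply: min_u; apply: Llin.
Qed.

(** * Bounded and self-adjoint operators *)

Lemma bounded_gt0 A : bounded_operator A ->
  exists2 M : K, 0 < M & forall x, `|A x| <= M * `|x|.
Proof.
move=> [_ [M AM]]; exists (`|M| + 1); first by rewrite ltr_wpDl.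
move=> x; apply: (@le_trans _ _ (`|M| * `|x|)); last first.
  by rewrite ler_wpM2r // lerDl.
rewrite -[leRHS]ger0_norm ?mulr_ge0 // normrM normr_id -normrM.
apply: le_trans (AM x) _; apply: real_ler_norm.
exact/ger0_real/(le_trans _ (AM x)).
Qed.

Lemma bounded_operator_comp A B :
  bounded_operator A -> bounded_operator B -> bounded_operator (A \o B).
Proof.
move=> bA bB; have [[lA _] [lB _]] := (bA, bB).
have [M M0 AM] := bounded_gt0 bA; have [N N0 BN] := bounded_gt0 bB.
split=> [a x y|]; first by rewrite /= lB lA.
exists (M * N) => x; rewrite -mulrA; apply: le_trans (AM _) _.
by rewrite ler_pM2l.
Qed.

Lemma self_adjoint_le A x : self_adjoint ip A -> ip (A x) x <= `|A x| * `|x|.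
Proof.
move=> sA; apply: le_trans (cauchy_schwarz _ _); apply: real_ler_norm.
(* Self-adjointness makes the form real: its value is plus or minus its modulus. *)
have : ip (A x) x ^+ 2 = `|ip (A x) x| ^+ 2.
  by rewrite -norm_ipC -sA expr2.
move/eqP; rewrite eqf_sqr => /orP[] /eqP ->; rewrite ?realN; exact: normr_real.
Qed.

(** A positive contraction satisfies [A^2 <= A], hence [|x - A x|^2 = |x|^2 - 2 <A x, x> + |A x|^2
    <= |x|^2 - <A x, x>]. *)
Lemma contraction_sub A : linear A -> self_adjoint ip A ->
    (forall x, 0 <= ip (A x) x) -> (forall x, `|A x| <= `|x|) ->
  forall x, `|x - A x| <= `|x|.
Proof.
move=> lA sA pA cA x.
rewrite -ler_sqr ?nnegrE // norm_sub sA.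
have hA : `|A x| ^+ 2 <= ip x (A x).
  (* This says [A - 2 A^2 + A^3 >= 0]; adding [A^3 <= A^2] leaves [A^2 <= A]. *)
  have h1 := pA (x - A x).
  have h2 : ip (A (A x)) (A x) <= `|A x| ^+ 2.
    apply: le_trans (self_adjoint_le _ sA) _.
    by rewrite expr2 ler_wpM2r.
  rewrite -subr_ge0 in h2; rewrite -subr_ge0.
  have := addr_ge0 h1 h2.
  rewrite (linear_opB lA) ipBl !ipBr /= [ip (A (A x)) x]sA sA.
  by rewrite ip_norm => h3; congr (is_true (_ <= _)): h3; ring.
have h4 : 0 <= ip x (A x) by rewrite -sA.
rewrite -subr_ge0 in hA; rewrite -subr_ge0.
by have h5 := addr_ge0 hA h4; congr (is_true (_ <= _)): h5; ring.
Qed.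

(** * Square roots of positive operators by iteration *)

Section SquareRootIteration.
Variable C : H -> H.
Hypotheses (linC : linear C) (saC : self_adjoint ip C).
Hypothesis contrC : forall x, `|C x| <= `|x|.

(* A fixed point X of X |-> (C + X^2) / 2 satisfies (1 - X)^2 = 1 - C. *)
Fixpoint sqrt_iter n x :=
  if n is m.+1 then 2^-1 *: (C x + sqrt_iter m (sqrt_iter m x)) else 0.

(* The same iteration for C = 1: since X_(n+1)^2 - X_n^2 is
   X_(n+1) (X_(n+1) - X_n) + (X_(n+1) - X_n) X_n, the norms of X_n and of
   X_(n+1) - X_n are majorized by a_n and a_(n+1) - a_n. *)
Fixpoint sqrt_iter_norm n : K :=
  if n is m.+1 then 2^-1 * (1 + sqrt_iter_norm m ^+ 2) else 0.

Local Notation X := sqrt_iter.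
Local Notation a := sqrt_iter_norm.

Lemma half_gt0 : 0 < 2^-1 :> K. Proof. by rewrite invr_gt0 ltr0n. Qed.

Lemma half_ge0 : 0 <= 2^-1 :> K. Proof. exact: ltW half_gt0. Qed.

Lemma sqrt_iter_norm_itv n : 0 <= a n <= 1.
Proof.
elim: n => [|n /andP[a0 a1]] /=; first by rewrite lexx ler01.
rewrite mulr_ge0 ?half_ge0 ?addr_ge0 ?exprn_ge0 //=.
by rewrite mulrC ler_pdivrMr ?ltr0n // mul1r lerD // exprn_ile1.
Qed.

Lemma sqrt_iter_norm_ge0 n : 0 <= a n.
Proof. by case/andP: (sqrt_iter_norm_itv n). Qed.

Lemma sqrt_iter_norm_le1 n : a n <= 1.
Proof. by case/andP: (sqrt_iter_norm_itv n). Qed.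

(** The error [b = 1 - a n] evolves by [f b = b - b^2 / 2], which forces decay like [2 / n]. *)
Lemma sqrt_iter_norm_rate n : 1 - a n <= 2 * n.+2%:R^-1.
Proof.
elim: n => [|n IHn] /=; first by rewrite subr0 divff ?pnatr_eq0.
have a0 := sqrt_iter_norm_ge0 n.
set N : K := n.+2%:R in IHn.
have N2 : 2 <= N by rewrite ler_nat.
have N0 : 0 < N by rewrite ltr0n.
have -> : n.+3%:R = N + 1 :> K by rewrite -natr1.
have N1 : 0 < N + 1 by rewrite addr_gt0.
rewrite -subr_ge0.
(* The two summands are [2 / (N + 1) - f (2 / N)] and [f (2 / N) - f (1 - a n)], for
   [f b = b - b^2 / 2]. *)
have -> : 2 / (N + 1) - (1 - 2^-1 * (1 + a n ^+ 2)) =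
    2 / ((N + 1) * N ^+ 2) +
    (2 / N - (1 - a n)) * (2^-1 * ((1 - 2 / N) + a n)).
  by field; rewrite !lt0r_neq0.
apply: addr_ge0; first by apply/ltW; rewrite divr_gt0 // mulr_gt0 // exprn_gt0.
rewrite mulr_ge0 ?subr_ge0 // mulr_ge0 ?half_ge0 // addr_ge0 // subr_ge0.
by rewrite ler_pdivrMr // mul1r.
Qed.

Lemma sqrt_iterS n x : X n.+1 x = 2^-1 *: (C x + X n (X n x)).
Proof. by []. Qed.

Lemma sqrt_iter_linear n : linear (X n).
Proof.
elim: n => [|n IHn] b x y; first by rewrite /= scaler0 addr0.
rewrite !sqrt_iterS !IHn linC !scalerDr !scalerA [b * _]mulrC.
by rewrite addrACA.
Qed.

Lemma sqrt_iter_self_adjoint n : self_adjoint ip (X n).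
Proof.
elim: n => [|n IHn] x y; first by rewrite /= linear0l linear0r.
rewrite !sqrt_iterS ipZl ipZr (theta_gt0 half_gt0) ipDl ipDr /=.
by rewrite saC !IHn.
Qed.

Lemma sqrt_iter_bound n x : `|X n x| <= a n * `|x|.
Proof.
elim: n x => [|n IHn] x; first by rewrite /= normr0 mul0r.
rewrite sqrt_iterS normrZ gtr0_norm ?half_gt0 //= -mulrA ler_pM2l ?half_gt0 //.
apply: le_trans (ler_normD _ _) _; rewrite mulrDl mul1r lerD //.
apply: le_trans (IHn _) _; rewrite expr2 -mulrA ler_wpM2l ?sqrt_iter_norm_ge0 //.
Qed.

Lemma sqrt_iter_contract n x : `|X n x| <= `|x|.
Proof.
apply: le_trans (sqrt_iter_bound _ _) _.
by rewrite ler_piMl // sqrt_iter_norm_le1.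
Qed.

Lemma sqrt_iter_step n x : `|X n.+1 x - X n x| <= (a n.+1 - a n) * `|x|.
Proof.
elim: n x => [|n IHn] x.
  rewrite /= !subr0 addr0 expr0n /= addr0 mulr1 normrZ gtr0_norm ?half_gt0 //.
  by rewrite ler_pM2l ?half_gt0.
rewrite (sqrt_iterS n.+1) {1}sqrt_iterS -scalerBr opprD addrACA subrr add0r.
have -> : X n.+1 (X n.+1 x) - X n (X n x) =
    X n.+1 (X n.+1 x - X n x) + (X n.+1 (X n x) - X n (X n x)).
  by rewrite (linear_opB (sqrt_iter_linear n.+1)) addrA subrK.
have a1 := sqrt_iter_norm_ge0 n.+1.
have da : 0 <= (a n.+1 - a n) * `|x| := le_trans (normr_ge0 _) (IHn x).
rewrite normrZ gtr0_norm ?half_gt0 //.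
have -> : (a n.+2 - a n.+1) * `|x| =
    2^-1 * (a n.+1 * ((a n.+1 - a n) * `|x|) + (a n.+1 - a n) * (a n * `|x|)).
  have aS k : a k.+1 = 2^-1 * (1 + a k ^+ 2) by [].
  by rewrite (aS n.+1) {2}(aS n); ring.
rewrite ler_pM2l ?half_gt0 //; apply: le_trans (ler_normD _ _) _.
rewrite lerD //.
  by apply: le_trans (sqrt_iter_bound _ _) _; rewrite ler_wpM2l.
(* The sign of [a n.+1 - a n] is read off from [da] by cancelling [|x|], so [x = 0] is treated
   apart. *)
apply: le_trans (IHn _) _; have [x0|x0] := eqVneq x 0.
  by rewrite x0 (linear_op0 (sqrt_iter_linear n)) !normr0 !mulr0.
rewrite ler_wpM2l ?sqrt_iter_bound //.
by rewrite pmulr_lge0 ?normr_gt0 in da.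
Qed.

(** The steps telescope to [(a m - a n) * |x|], and [a m - a n <= 1 - a n]. *)
Lemma sqrt_iter_rate n m x : (n <= m)%N -> `|X n x - X m x| <= 2 * `|x| * rate n.
Proof.
move=> nm; apply: (@le_trans _ _ ((a m - a n) * `|x|)).
  rewrite distrC -(subnK nm); elim: (m - n)%N => [|k IHk].
    by rewrite !subrr normr0 mul0r.
  rewrite addSn.
  have -> : X (k + n).+1 x - X n x =
      X (k + n).+1 x - X (k + n)%N x + (X (k + n)%N x - X n x).
    by rewrite addrA subrK.
  have -> : a (k + n).+1 - a n = a (k + n).+1 - a (k + n)%N + (a (k + n)%N - a n).
    by rewrite addrA subrK.
  apply: le_trans (ler_normD _ _) _.
  by rewrite mulrDl lerD // sqrt_iter_step.
rewrite mulrAC ler_wpM2r //; apply: (@le_trans _ _ (1 - a n)).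
  by rewrite lerD2r sqrt_iter_norm_le1.
apply: le_trans (sqrt_iter_norm_rate n) _.
by rewrite ler_pM2l ?ltr0n // rate_le.
Qed.

(** [Y] is the pointwise limit of [X n]. Each property passes to it by inserting [X n] and bounding
    the error by a multiple of [rate n]. *)
Lemma sqrt_iter_limit : exists Y : H -> H,
  [/\ linear Y, self_adjoint ip Y, forall x, `|Y x| <= `|x| &
      forall x, Y x = 2^-1 *: (C x + Y (Y x))].
Proof.
have lim x : exists y, forall n, `|X n x - y| <= 2 * `|x| * rate n.
  by apply: complete_rate => n m; exact: sqrt_iter_rate.
have [Y YP] := choice lim.
have YP' x n : `|Y x - X n x| <= 2 * `|x| * rate n by rewrite distrC.
have cY x : `|Y x| <= `|x|.
  apply: (@le_rate _ _ (2 * `|x|)) => // n.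
  rewrite -[Y x](subrK (X n x)) addrC; apply: le_trans (ler_normD _ _) _.
  by rewrite lerD // sqrt_iter_contract.
exists Y; split => //.
- move=> b x y; apply/eqP; rewrite -subr_eq0; apply/eqP.
  apply: (@rate_eq0 _ (2 * `|b *: x + y| + `|b| * (2 * `|x|) + 2 * `|y|)) => n.
  have -> : Y (b *: x + y) - (b *: Y x + Y y) =
      (Y (b *: x + y) - X n (b *: x + y)) + b *: (X n x - Y x) + (X n y - Y y).
    by rewrite sqrt_iter_linear scalerBr -[RHS]addrA [_ - _ + (_ - _)]addrACA
      -opprD addrA subrK.
  apply: le_trans (ler_normD _ _) _; rewrite 2!mulrDl lerD //.
  apply: le_trans (ler_normD _ _) _; rewrite lerD //.
  by rewrite normrZ -mulrA ler_wpM2l.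
- move=> x y; apply/eqP; rewrite -subr_eq0; apply/eqP.
  apply: (@scalar_rate_eq0 _ (4 * (`|x| * `|y|))) => n.
  have -> : ip (Y x) y - ip x (Y y) = ip (Y x - X n x) y + ip x (X n y - Y y).
    by rewrite ipBl ipBr /= sqrt_iter_self_adjoint addrA subrK.
  apply: le_trans (ler_normD _ _) _.
  have -> : 4 * (`|x| * `|y|) * rate n =
    2 * `|x| * rate n * `|y| + `|x| * (2 * `|y| * rate n) by ring.
  by apply: lerD; apply: le_trans (cauchy_schwarz _ _) _;
    rewrite ?ler_wpM2r ?ler_wpM2l.
move=> x; apply/eqP; rewrite -subr_eq0; apply/eqP.
apply: (@rate_eq0 _ (2 * `|x| + 2^-1 * (2 * `|x| + 2 * `|Y x|))) => n.
(* The split of [X n (X n x) - Y (Y x)] uses the contraction [X n] on one term and convergence at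
   the point [Y x] on the other. *)
have -> : Y x - 2^-1 *: (C x + Y (Y x)) = (Y x - X n.+1 x) +
    2^-1 *: (X n (X n x - Y x) + (X n (Y x) - Y (Y x))).
  have -> : X n (X n x - Y x) + (X n (Y x) - Y (Y x)) = X n (X n x) - Y (Y x).
    by rewrite (linear_opB (sqrt_iter_linear n)) addrA subrK.
  rewrite sqrt_iterS -[RHS]addrA; congr (_ + _).
  rewrite [RHS]addrC -scalerBr -scalerN; congr (_ *: _).
  by rewrite !opprD [RHS]addrC addrA subrK.
apply: le_trans (ler_normD _ _) _; rewrite mulrDl lerD //.
  by apply: le_trans (YP' _ _) _; rewrite ler_wpM2l ?mulr_ge0 // rate_le.
rewrite normrZ gtr0_norm ?half_gt0 // -mulrA ler_pM2l ?half_gt0 //.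
apply: le_trans (ler_normD _ _) _; rewrite mulrDl lerD //.
by apply: le_trans (sqrt_iter_contract _ _) _.
Qed.

End SquareRootIteration.

(** Scale [A] to a contraction [A' = A / s^2] and take the fixed point [Y] for [C = 1 - A']. Then
    [(1 - Y)^2 = A'], and the root is [s (1 - Y)]. *)
Lemma square_root_exists A : bounded_positive ip A ->
  exists B, bounded_positive ip B /\ B \o B = A.
Proof.
move=> [bA sA pA]; have [lA _] := bA; have [M M0 AM] := bounded_gt0 bA.
(* This choice gives [s^2 >= M] whatever the size of [M]. *)
pose s : K := M + 1; have s0 : 0 < s by rewrite addr_gt0.
have s20 : 0 < s ^- 2 by rewrite invr_gt0 exprn_gt0.
pose A' x := s ^- 2 *: A x.
have lA' : linear A'.
  by move=> b x y; rewrite /A' lA scalerDr !scalerA [b * _]mulrC.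
have sA' : self_adjoint ip A'.
  by move=> x y; rewrite /A' ipZl ipZr (theta_gt0 s20) sA.
have pA' x : 0 <= ip (A' x) x by rewrite ipZl mulr_ge0 // ltW.
have cA' x : `|A' x| <= `|x|.
  rewrite normrZ gtr0_norm // mulrC ler_pdivrMr ?exprn_gt0 //.
  apply: le_trans (AM x) _; rewrite mulrC ler_wpM2l //.
  have -> : s ^+ 2 = M + (M ^+ 2 + M + 1) by rewrite /s; ring.
  by rewrite lerDl !addr_ge0 ?exprn_ge0 // ltW.
have lC : linear (fun x => x - A' x).
  by move=> b x y; rewrite lA' scalerBr opprD addrACA.
have sC : self_adjoint ip (fun x => x - A' x).
  by move=> x y; rewrite ipBl ipBr sA'.
have [Y [lY sY cY YE]] := sqrt_iter_limit lC sC (contraction_sub lA' sA' pA' cA').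
exists (fun x => s *: (x - Y x)); split; last first.
  apply: funext => x /=; rewrite (linear_opZ lY) -scalerBr scalerA.
  have YY : Y (Y x) = 2 *: Y x - (x - A' x).
    rewrite {2}[Y x]YE scalerA divff ?pnatr_eq0 // scale1r.
    by rewrite addrAC subrr add0r.
  rewrite (linear_opB lY) YY scaler_nat mulr2n.
  have -> : x - Y x - (Y x - (Y x + Y x - (x - A' x))) = A' x.
    rewrite [in - (Y x - _)]opprB [Y x + Y x - _ - Y x]addrAC addrK.
    by rewrite addrA subrK subKr.
  by rewrite /A' scalerA -expr2 divff ?scale1r // expf_neq0 // lt0r_neq0.
(* Positivity of the root comes from [Y] being a self-adjoint contraction. *)
have psY x : 0 <= ip (x - Y x) x.
  rewrite ipBl subr_ge0; apply: le_trans (self_adjoint_le _ sY) _.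
  by rewrite ip_norm expr2 ler_wpM2r.
split.
- split=> [b x y|].
    rewrite lY opprD addrACA -scalerBr !scalerDr !scalerA.
    by rewrite [b * _]mulrC.
  exists (s * 2) => x; rewrite normrZ gtr0_norm // -mulrA ler_pM2l //.
  apply: le_trans (ler_normB _ _) _.
  by rewrite mulrC mulr_natr mulr2n lerD2l.
- by move=> x y; rewrite ipZl ipZr (theta_gt0 s0) ipBl ipBr sY.
by move=> x; rewrite ipZl mulr_ge0 // ltW.
Qed.

Lemma sqrt_operatorP A : bounded_positive ip A ->
  bounded_positive ip (sqrt_operator ip A) /\
  sqrt_operator ip A \o sqrt_operator ip A = A.
Proof. by move=> /square_root_exists; apply: xgetPex. Qed.

(** * Orthogonal projectors *)

Lemma orthogonal_complement_subspace L :
  linear_subspace (orthogonal_complement ip L).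
Proof.
split=> [y _|b x y xL yL z Lz]; first by rewrite linear0l.
by rewrite ipDl ipZl (xL _ Lz) (yL _ Lz) mulr0 addr0.
Qed.

(* P x lies in the closure of L, as a limit at rate 1/n of points of L. *)
Definition is_projector L (P : H -> H) :=
  (forall x n, exists2 y, L y & `|y - P x| <= 2 * rate n) /\
  (forall x, orthogonal_complement ip L (x - P x)).

Lemma projector_exists L : linear_subspace L -> exists P, is_projector L P.
Proof.
move=> /orthogonal_projection LP; have [P PP] := choice LP.
by exists P; split=> x; have [] := PP x.
Qed.

Section Projector.
Variables (L : set H) (P : H -> H).
Hypothesis projP : is_projector L P.

Lemma projector_ortho x y : orthogonal_complement ip L y -> ip (P x) y = 0.
Proof.
move=> yL; apply: (@scalar_rate_eq0 _ (2 * `|y|)) => n.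
have [z Lz zP] := projP.1 x n.
have -> : ip (P x) y = ip (P x - z) y.
  by rewrite ipBl (proj1 (ip_eq0C y z)) ?subr0 //; apply: yL.
apply: le_trans (cauchy_schwarz _ _) _.
by rewrite mulrAC ler_wpM2r // distrC.
Qed.

(** [P x - p] lies in the complement of [L] and is orthogonal to it, hence to itself. Since [P] is
    chosen pointwise, its linearity rests on this. *)
Lemma projector_uniq x p : orthogonal_complement ip L (x - p) ->
  (forall y, orthogonal_complement ip L y -> ip p y = 0) -> P x = p.
Proof.
move=> xp pL; apply/eqP; rewrite -subr_eq0; apply/eqP/ip_eq0.
have d : orthogonal_complement ip L (P x - p).
  have -> : P x - p = -1 *: (x - P x) + (x - p).
    by rewrite scaleN1r opprB addrA subrK.
  by apply: (orthogonal_complement_subspace L).2 => //; apply: projP.2.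
by rewrite {1}ipBl projector_ortho // pL // subr0.
Qed.

Lemma projector_linear : linear P.
Proof.
move=> b x y; apply: projector_uniq => [|z zL].
  rewrite opprD addrACA -scalerBr.
  by apply: (orthogonal_complement_subspace L).2; apply: projP.2.
by rewrite ipDl ipZl !projector_ortho // mulr0 addr0.
Qed.

Lemma projector_id x : L x -> P x = x.
Proof.
move=> Lx; apply: projector_uniq => [|y yL].
  by rewrite subrr; apply: (orthogonal_complement_subspace L).1.
by apply/ip_eq0C; apply: yL.
Qed.

Lemma projector_eq0 x : orthogonal_complement ip L x -> P x = 0.
Proof.
move=> xL; apply: projector_uniq => [|y _]; first by rewrite subr0.
by rewrite linear0l.
Qed.

Lemma projector_self_adjoint : self_adjoint ip P.
Proof.
move=> x y.
have -> : ip (P x) y = ip (P x) (P y).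
  apply/eqP; rewrite -subr_eq0 -ipBr projector_ortho //; exact: projP.2.
apply/eqP; rewrite eq_sym -subr_eq0 -ipBl; apply/eqP/ip_eq0C.
by rewrite projector_ortho //; apply: projP.2.
Qed.

Lemma projector_form x : ip (P x) x = `|P x| ^+ 2.
Proof.
rewrite -ip_norm; apply/eqP; rewrite -subr_eq0 -ipBr projector_ortho //.
exact: projP.2.
Qed.

Lemma projector_pythagoras x : `|x| ^+ 2 = `|x - P x| ^+ 2 + `|P x| ^+ 2.
Proof.
have xP := projector_ortho x (projP.2 x).
rewrite -[in LHS](subrK (P x) x) (norm_add (x - P x)) xP.
by rewrite (proj2 (ip_eq0C _ _) xP) !addr0.
Qed.

Lemma projector_contract x : `|P x| <= `|x|.
Proof.
rewrite -ler_sqr ?nnegrE // [leRHS]projector_pythagoras lerDr.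
by rewrite exprn_ge0.
Qed.

Lemma projector_bounded : bounded_operator P.
Proof.
split; first exact: projector_linear.
by exists 1 => x; rewrite mul1r projector_contract.
Qed.

End Projector.

(** * Comparison of ranges *)

(* With C* = Ca and C'* = Ca', the hypothesis gives |C x| = |C' x|: a sequence
   C x_n converging to the component of z in the closure of ran C makes C' x_n
   Cauchy, and Ca' sends its limit to Ca z. *)
Lemma range_adjoint_sub (C Ca C' Ca' : H -> H) :
  linear C -> linear C' -> bounded_operator Ca -> bounded_operator Ca' ->
  (forall x y, ip (C x) y = ip x (Ca y)) ->
  (forall x y, ip (C' x) y = ip x (Ca' y)) ->
  (forall x, Ca (C x) = Ca' (C' x)) -> range Ca `<=` range Ca'.
Proof.
move=> lC lC' bCa bCa' adjC adjC' CC y [z _ <-{y}].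
have [[lCa _] [lCa' _]] := (bCa, bCa').
have subC : linear_subspace (range C).
  split=> [|b _ _ [x _ <-] [y _ <-]]; first by exists 0 => //; exact: linear_op0.
  by exists (b *: x + y) => //; rewrite lC.
have [p [pC zp]] := orthogonal_projection z subC.
(* With [v = Ca (z - p)], [<v, v> = <C v, z - p> = 0]. *)
have Caz : Ca z = Ca p.
  apply/eqP; rewrite -subr_eq0 -(linear_opB lCa); apply/eqP/ip_eq0.
  rewrite -adjC; apply/ip_eq0C.
  by apply: zp; exists (Ca (z - p)).
have near n : exists x, `|C x - p| <= 2 * rate n.
  by have [_ [x _ <-] xp] := pC n; exists x.
have [x xp] := choice near.
have normCC u : `|C' u| = `|C u|.
  apply/eqP; rewrite -(@eqrXn2 _ 2) //; apply/eqP.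
  by rewrite -!ip_norm adjC adjC' CC.
have [n m nm|w xw] := @complete_rate (fun n => C' (x n)) 4.
  rewrite -(linear_opB lC') normCC (linear_opB lC).
  have -> : C (x n) - C (x m) = (C (x n) - p) + (p - C (x m)).
    by rewrite addrA subrK.
  apply: le_trans (ler_normD _ _) _.
  have -> : 4 * rate n = 2 * rate n + 2 * rate n by ring.
  rewrite lerD // distrC; apply: le_trans (xp m) _.
  by rewrite ler_pM2l ?ltr0n // rate_le.
exists w => //; rewrite Caz; apply/eqP; rewrite -subr_eq0; apply/eqP.
have [M M0 CaM] := bounded_gt0 bCa; have [N N0 CaN] := bounded_gt0 bCa'.
apply: (@rate_eq0 _ (N * 4 + M * 2)) => n.
have -> : Ca' w - Ca p = Ca' (w - C' (x n)) + Ca (C (x n) - p).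
  by rewrite (linear_opB lCa) (linear_opB lCa') CC addrA subrK.
apply: le_trans (ler_normD _ _) _.
rewrite mulrDl -!mulrA lerD //.
  by apply: le_trans (CaN _) _; rewrite ler_pM2l // distrC.
by apply: le_trans (CaM _) _; rewrite ler_pM2l.
Qed.

(** * The Krein-von Neumann extension and the range identity *)

Section KreinVonNeumann.
Variables (D : set H) (T S P : H -> H).
Hypotheses (subD : linear_subspace D) (extS : positive_extension ip D T S).
Let Q := sqrt_operator ip S.
Hypothesis projP : is_projector (Q @` D) P.

Lemma sqrt_extension : bounded_positive ip Q /\ forall x, Q (Q x) = S x.
Proof.
have [bpQ QQ] := sqrt_operatorP extS.1.
by split=> // x; rewrite -[in RHS]QQ.
Qed.

Lemma sqrt_image_subspace : linear_subspace (Q @` D).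
Proof.
have [[[lQ _] _ _] _] := sqrt_extension.
split=> [|b _ _ [x Dx <-] [y Dy <-]].
  by exists 0; [apply: subD.1|exact: linear_op0].
by exists (b *: x + y); [apply: subD.2|rewrite lQ].
Qed.

Lemma compression_smallest : smallest_positive_extension ip D T (Q \o P \o Q).
Proof.
have [[bQ sQ pQ] QQ] := sqrt_extension; have subQ := sqrt_image_subspace.
have formE x : ip (Q (P (Q x))) x = `|P (Q x)| ^+ 2.
  by rewrite sQ (projector_form projP).
split.
  split; first split.
  - by do 2?apply: bounded_operator_comp => //; apply: projector_bounded projP.
  - by move=> x y /=; rewrite sQ (projector_self_adjoint projP) sQ.
  - by move=> x /=; rewrite formE exprn_ge0.
  move=> x Dx /=; rewrite (projector_id projP) ?QQ; first exact: extS.2.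
  by exists x.
move=> S' [[[lS' _] sS' pS'] S'T] x /=; rewrite formE.
apply: (@le_rate _ _ 4); [exact: exprn_ge0|exact: pS'|move=> n].
have [_ [d Dd <-] dP] := projP.1 (Q x) n.
have S'd : S' d = Q (Q d) by rewrite S'T // QQ extS.2.
have PQd : P (Q d) = Q d by apply: (projector_id projP); exists d.
(* Positivity of [S'] at [x - d], where [S' d = Q (Q d)]. *)
have h : 0 <= ip (S' x) x - ip (Q x) (Q d) - ip (Q d) (Q x) + `|Q d| ^+ 2.
  have := pS' (x - d).
  rewrite (linear_opB lS') ipBl !ipBr (sS' x d) S'd -(sQ x) !(sQ (Q d)) ip_norm.
  by rewrite opprB addrA addrAC.
(* Since [P] fixes [Q d], this turns [h] into [|P Q x|^2 <= <S' x, x> + |P Q x - Q d|^2]. *)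
have e : `|Q x - Q d| ^+ 2 = `|Q x - P (Q x)| ^+ 2 + `|P (Q x) - Q d| ^+ 2.
  have := projector_pythagoras projP (Q x - Q d).
  rewrite (linear_opB (projector_linear projP)) PQd => ->.
  by rewrite opprB addrA subrK.
rewrite norm_sub in e.
have pyth := projector_pythagoras projP (Q x).
apply: (@le_trans _ _ (ip (S' x) x + `|P (Q x) - Q d| ^+ 2)).
  rewrite -subr_ge0; congr (is_true (_ <= _)): h.
  transitivity (ip (S' x) x - `|Q x| ^+ 2 +
    (`|Q x| ^+ 2 - ip (Q x) (Q d) - ip (Q d) (Q x) + `|Q d| ^+ 2)); first by ring.
  by rewrite e [in LHS]pyth; ring.
(* The constant 4 arises from [(2 * rate n)^2 <= 4 * rate n], as [rate n <= 1]. *)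
rewrite lerD2l distrC; apply: (@le_trans _ _ ((2 * rate n) ^+ 2)).
  by rewrite ler_sqr ?nnegrE // mulr_ge0 // rate_ge0.
rewrite exprMn -natrX ler_pM2l ?ltr0n // expr2 ler_piMr ?rate_ge0 //.
by have := rate_le (leq0n n); rewrite invr1.
Qed.

Lemma smallest_extension_uniq A B :
  smallest_positive_extension ip D T A ->
  smallest_positive_extension ip D T B -> A = B.
Proof.
move=> [eA mA] [eB mB].
have AB : forall x, ip (A x) x = ip (B x) x.
  by move=> x; apply/eqP; rewrite eq_le (mA _ eB) (mB _ eA).
have [[[[lA _] sA _] _] [[[lB _] sB _] _]] := (eA, eB).
pose F x := A x - B x.
have F0 x : ip (F x) x = 0 by rewrite ipBl AB subrr.
have lF : linear F by move=> b x y; rewrite /F lA lB scalerBr opprD addrACA.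
have sF : self_adjoint ip F by move=> x y; rewrite ipBl ipBr sA sB.
apply: funext => x; apply/eqP; rewrite -subr_eq0; apply/eqP/ip_eq0.
rewrite -/(F x).
(* By self-adjointness the form of [F] at [x + F x] reduces to [2 <F x, F x>]; this polarization
   works over real scalars too. *)
have := F0 (x + F x); rewrite (linear_opD lF) ipDl !(ipDr _ x) !F0.
rewrite add0r addr0 (sF (F x)).
by move/eqP; rewrite -mulr2n mulrn_eq0 /= => /eqP.
Qed.

Lemma krein_von_neumannE : krein_von_neumann ip D T = Q \o P \o Q.
Proof.
apply: smallest_extension_uniq compression_smallest.
(* The compression witnesses existence, so [xget] does not fall back on its default. *)
by apply: (@xgetPex _ (fun=> 0)); exists (Q \o P \o Q); apply: compression_smallest.
Qed.

Lemma range_sqrt_sub_krein_von_neumann :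
  range (sqrt_operator ip (S \- krein_von_neumann ip D T)) =
  range Q `&` orthogonal_complement ip D.
Proof.
have [[bQ sQ pQ] QQ] := sqrt_extension; have subQ := sqrt_image_subspace.
have lQ := bQ.1.
have bP := projector_bounded projP.
have lP := bP.1; have sP := projector_self_adjoint projP.
pose E x := x - P x.
have PE x : P (E x) = 0 by apply: (projector_eq0 projP); apply: projP.2.
have lE : linear E by move=> b x y; rewrite /E lP scalerBr opprD addrACA.
have sE : self_adjoint ip E by move=> x y; rewrite ipBl ipBr sP.
have bE : bounded_operator E.
  by split=> //; exists 1 => x; rewrite mul1r; apply: contraction_sub x => //;
    [move=> x; rewrite (projector_form projP) exprn_ge0
    |apply: projector_contract projP].
have SA : S \- krein_von_neumann ip D T = Q \o E \o Q.
  by apply: funext => x; rewrite krein_von_neumannE /= /E (linear_opB lQ) QQ.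
have EE x : E (E x) = E x by rewrite {1}/E PE subr0.
have bQE : bounded_operator (Q \o E) by apply: bounded_operator_comp.
have lEQ : linear (E \o Q) by move=> b x y; rewrite /= lQ lE.
have bpSA : bounded_positive ip (Q \o E \o Q).
  split; first exact: bounded_operator_comp.
    by move=> x y; rewrite /= sQ sE sQ.
  by move=> x; rewrite /= sQ -EE sE ip_norm exprn_ge0.
have [[bB sB _] BB] := sqrt_operatorP bpSA.
rewrite SA; set B := sqrt_operator _ _ in bB sB BB *.
have BBE x : B (B x) = Q (E (E (Q x))) by rewrite -[LHS]/((B \o B) x) BB EE.
have adj x y : ip ((E \o Q) x) y = ip x ((Q \o E) y) by rewrite /= sE sQ.
(* Both [B B] and [(Q E) (E Q)] equal [S - T_N], with [B] its own adjoint and [E Q] adjoint to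
   [Q E]; the comparison is applied both ways. *)
have -> : range B = range (Q \o E).
  by apply/seteqP; split; [apply: (@range_adjoint_sub B _ (E \o Q))
    |apply: (@range_adjoint_sub (E \o Q) _ B)] => //; exact: bB.1.
apply/seteqP; split=> [_ [x _ <-]|_ [[x _ <-] QxD]].
  split; first by exists (E x).
  move=> d Dd; rewrite /= sQ; apply: projP.2; by exists d.
(* [Q x] orthogonal to [D] means [x] orthogonal to [Q D], so [E x = x]. *)
exists x => //=; rewrite /E (projector_eq0 projP) ?subr0 // => _ [d Dd <-].
by rewrite -sQ QxD.
Qed.

End KreinVonNeumann.
End Hilbert.

(** * Real and complex scalars *)

Lemma scalar_conj_norm (R : realType) k (z : scalars R k) :
  z * scalar_conj z = `|z| ^+ 2.
Proof.
case: k z => /= z; last by rewrite sqr_normc.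
by rewrite real_normK ?num_real.
Qed.

Lemma scalar_archimedean (R : realType) k (e : scalars R k) :
  0 < e -> exists n, n.+1%:R^-1 < e.
Proof.
have archi (r : R) : 0 < r -> exists n, n.+1%:R^-1 < r.
  move=> r0; have [N _ /(_ N (leqnn N))] := near_infty_natSinv_lt (PosNum r0).
  by exists N.
case: k e => /= e; first exact: archi.
(* A positive element of [R[i]] has zero imaginary part, which reduces the claim to [R]. *)
rewrite ltcE => /andP[/eqP /= ei /archi [n ne]]; exists n.
have -> : e = (complex.Re e)%:C%C by case: e ei {ne} => a b /= ->.
have -> : n.+1%:R^-1 = (n.+1%:R^-1 : R)%:C%C by rewrite fmorphV rmorph_nat.
by rewrite ltcR.
Qed.

Theorem theorem7p4 (R : realType) (k : scalar_kind)
    (H : completeNormedModType (scalars R k))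
    (ip : {dot H for scalar_conj}) (ip_norm : induces_norm ip)
    (D : set H) (D_subspace : linear_subspace D)
    (T : H -> H) (T_linear : linear_on D T)
    (T_extendable : exists S0 : H -> H, positive_extension ip D T S0)
    (S : H -> H) (S_extension : positive_extension ip D T S) :
  range (sqrt_operator ip (S \- krein_von_neumann ip D T)) =
  range (sqrt_operator ip S) `&` orthogonal_complement ip D.
Proof.
have theta_norm := @scalar_conj_norm R k.
have archi := @scalar_archimedean R k.
have subQ := sqrt_image_subspace theta_norm archi ip_norm D_subspace S_extension.
have [P projP] := projector_exists theta_norm archi ip_norm subQ.
exact: (range_sqrt_sub_krein_von_neumann theta_norm archi ip_norm D_subspace
  S_extension projP).
Qed.
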